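(* For all integers $n\ge 1$ and $m\ge 0$, $$\nu(n+m) > \frac{n+m}{3}-\sqrt{2(n+m)}-\frac{9}{2},$$ where, for a positive integer $w$, $\nu(w)$ denotes the number of Anosov graphs (up to isomorphism) whose number of vertices plus number of edges equals $w$.
   Context: A simple graph is a finite undirected graph $G=(V,E)$ without loops or multiple edges. For $x\in V$ let $N(x)=\{y\in V: xy\in E\}$ and $\overline{N}(x)=N(x)\cup\{x\}$. Write $x\sim y$ if $N(x)=N(y)$ or $\overline{N}(x)=\overline{N}(y)$; this is an equivalence relation on $V$. A connected simple graph $G$ is called Anosov if (1) every $\sim$-equivalence class has at least $2$ elements, and (2) every $\sim$-equivalence class with exactly $2$ elements is edgeless, i.e. its two vertices are not adjacent in $G$. *)

(* Defs.v *)
From HB Require Import structures.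
From mathcomp Require Import all_boot perm.

Set Implicit Arguments.
Unset Strict Implicit.
Unset Printing Implicit Defensive.

(* A graph (V, E) is given by its edge set E, a set of two-element subsets of
   the finite type V; x and y are adjacent when [set x; y] \in E. *)

Definition simple_graph (V : finType) (E : {set {set V}}) : bool :=
  [forall e in E, #|e| == 2].

Definition adj (V : finType) (E : {set {set V}}) : rel V :=
  fun x y => [set x; y] \in E.

Definition nbhd (V : finType) (E : {set {set V}}) (x : V) : {set V} :=
  [set y | adj E x y].

Definition closed_nbhd (V : finType) (E : {set {set V}}) (x : V) : {set V} :=
  x |: nbhd E x.

Definition twin (V : finType) (E : {set {set V}}) : rel V :=
  fun x y => (nbhd E x == nbhd E y) || (closed_nbhd E x == closed_nbhd E y).

Definition twin_classes (V : finType) (E : {set {set V}}) : {set {set V}} :=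
  equivalence_partition (twin E) [set: V].

Definition edgeless (V : finType) (E : {set {set V}}) (C : {set V}) : bool :=
  [forall x in C, forall y in C, ~~ adj E x y].

(* The graph on zero vertices counts as connected here; it contributes only to
   [nu 0]. *)
Definition connected_graph (V : finType) (E : {set {set V}}) : bool :=
  [forall x, forall y, connect (adj E) x y].

Definition anosov (V : finType) (E : {set {set V}}) : bool :=
  [&& simple_graph E,
      connected_graph E,
      [forall C in twin_classes E, 2 <= #|C|]
    & [forall C in twin_classes E, (#|C| == 2) ==> edgeless E C]].

Definition isomorphic (V : finType) : rel {set {set V}} :=
  fun E F => [exists s : {perm V}, forall x, forall y,
                adj F (s x) (s y) == adj E x y].

(* Number of isomorphism classes of Anosov graphs with k vertices and l edges;
   up to isomorphism the vertex set is 'I_k. *)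
Definition nb_anosov (k l : nat) : nat :=
  #|equivalence_partition (@isomorphic 'I_k)
      [set E : {set {set 'I_k}} | anosov E & #|E| == l]|.

Definition nu (w : nat) : nat := \sum_(k < w.+1) nb_anosov k (w - k).

(* [equivalence_partition] is meaningful only for equivalence relations. *)

Lemma adjC (V : finType) (E : {set {set V}}) (x y : V) : adj E x y = adj E y x.
Proof. by rewrite /adj setUC. Qed.

Lemma adj_irr (V : finType) (E : {set {set V}}) (x : V) :
  simple_graph E -> adj E x x = false.
Proof.
move=> /forall_inP sE; apply/negP => /sE.
by rewrite setUid cards1.
Qed.

Lemma twin_equiv (V : finType) (E : {set {set V}}) :
  simple_graph E -> {in [set: V] & &, equivalence_rel (twin E)}.
Proof.
move=> sE.
have mixed x y z : nbhd E x = nbhd E y -> closed_nbhd E y = closed_nbhd E z ->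
    x = y \/ y = z.
  move=> Nxy Nyz; case: (eqVneq x y) => [|xy]; first by left.
  case: (eqVneq y z) => [|yz]; [by right | exfalso].
  have yz' : adj E y z.
    have : z \in closed_nbhd E y by rewrite Nyz setU11.
    by rewrite in_setU1 eq_sym (negPf yz) /= inE.
  have xz : adj E x z.
    have : z \in nbhd E x by rewrite Nxy inE.
    by rewrite inE.
  have : x \in closed_nbhd E y by rewrite Nyz in_setU1 inE [adj E z x]adjC xz orbT.
  rewrite in_setU1 (negPf xy) /= inE => yx.
  have : y \in nbhd E x by rewrite inE adjC.
  by rewrite Nxy inE adj_irr.
have twinC x y : twin E x y = twin E y x.
  by rewrite /twin eq_sym [X in _ || X]eq_sym.
have twin_trans x y z : twin E x y -> twin E y z -> twin E x z.
  move=> /orP[/eqP a|/eqP a] /orP[/eqP b|/eqP b]; rewrite /twin.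
  - by rewrite a b eqxx.
  - case: (mixed _ _ _ a b) => c; first by rewrite c b eqxx orbT.
    by rewrite -c a eqxx.
  - case: (mixed _ _ _ (esym b) (esym a)) => c; first by rewrite c a eqxx orbT.
    by rewrite -c b eqxx.
  - by rewrite a b eqxx orbT.
move=> x y z _ _ _; split; first by rewrite /twin eqxx.
move=> xy; apply/idP/idP; first by apply: twin_trans; rewrite twinC.
exact: twin_trans.
Qed.

Lemma isomorphic_equiv (V : finType) : equivalence_rel (@isomorphic V).
Proof.
have isoC (E F : {set {set V}}) : isomorphic E F -> isomorphic F E.
  move=> /existsP[s /forallP sP]; apply/existsP; exists (s^-1)%g.
  apply/forallP => x; apply/forallP => y.
  have /forallP/(_ (s^-1 y)%g)/eqP := sP (s^-1 x)%g.
  by rewrite !permKV => ->.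
have iso_trans (E F G : {set {set V}}) :
    isomorphic E F -> isomorphic F G -> isomorphic E G.
  move=> /existsP[s /forallP sP] /existsP[t /forallP tP].
  apply/existsP; exists (s * t)%g; apply/forallP => x; apply/forallP => y.
  have /forallP/(_ y)/eqP <- := sP x.
  by have /forallP/(_ (s y))/eqP <- := tP (s x); rewrite !permM.
move=> E F G; split.
  by apply/existsP; exists 1%g; apply/forallP => x; apply/forallP => y;
     rewrite !perm1.
move=> EF; apply/idP/idP; first exact: (iso_trans _ _ _ (isoC _ _ EF)).
exact: iso_trans.
Qed.

(* Main.v *)
Require Import Defs.
From mathcomp Require Import all_boot all_order all_algebra reals.
From mathcomp Require Import perm zify lra.
Import Order.TTheory GRing.Theory Num.Theory.

(** Let w be the number of vertices plus edges.  The bound follows from one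
    family of Anosov graphs of weight w whose members are told apart by their
    number of vertices of degree 2.

    Take the path on five points and replace its points by classes of 2 + i, 2,
    f, 3 and d vertices, joining all vertices of consecutive classes, where the
    class of 3 is either edgeless or a triangle and the other classes are
    edgeless.  Vertices in one class are twins, and adjacent vertices in
    different classes are never twins, so the result is Anosov
    ([anosov_blowup]).  Exactly the vertices of the first class have degree 2.
    Each of them adds 3 to the weight: itself and two edges.  The rest of the
    graph weighs 5 + 6f + 4d, plus 3 when the class of 3 is a triangle; with f in
    {2, 3} this meets all four residues modulo 4, so by the choice of d >= 2 it
    can be every integer from 31 on.  Hence every i >= 0 with
    3(2 + i) + 31 <= w gives a graph of weight w, and nu w is at least
    (w - 34) / 3 rounded down, which is at least w/3 - 12 ([nu_ge_third]).

    Put x = sqrt (2w).  The bound of the theorem equals (x - 9)(x + 3) / 6, which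
    is negative for x < 9; for x >= 9 it is at most w/3 - 27/2. *)

Set Implicit Arguments.
Unset Strict Implicit.
Unset Printing Implicit Defensive.

(** * Blow-ups of a graph with loops *)

Lemma set2_inj (V : finType) (x y u v : V) :
  [set x; y] = [set u; v] -> (x = u /\ y = v) \/ (x = v /\ y = u).
Proof.
move=> e.
have /set2P xP : x \in [set u; v] by rewrite -e set21.
have /set2P yP : y \in [set u; v] by rewrite -e set22.
have /set2P uP : u \in [set x; y] by rewrite e set21.
have /set2P vP : v \in [set x; y] by rewrite e set22.
by case: xP yP uP vP => -> [->|->] [?|?] [?|?]; auto.
Qed.

Section Blowup.
Variables (V T : finType) (r : rel T) (col : V -> T).

(** A loop of [r] at [i] turns the class of [i] into a clique; without a loop
    that class is edgeless. *)
Definition blowup : {set {set V}} :=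
  [set [set u.1; u.2]
     | u in [set u : V * V | (u.1 != u.2) && r (col u.1) (col u.2)]].

Definition fibre (i : T) : {set V} := [set x | col x == i].

Hypothesis r_sym : symmetric r.

Lemma adj_blowup (x y : V) : adj blowup x y = (x != y) && r (col x) (col y).
Proof.
apply/imsetP/idP => [[[u v]]|xy]; last by exists (x, y); rewrite // inE.
rewrite inE /= => /andP[uv ruv] /set2_inj[][-> ->]; first by rewrite uv.
by rewrite eq_sym uv r_sym.
Qed.

Lemma simple_blowup : simple_graph blowup.
Proof.
apply/forall_inP => e /imsetP[[x y]]; rewrite inE /= => /andP[xy _] ->.
by rewrite cards2 xy.
Qed.

(** The sum over the colours adjacent to that of [x] counts [x] itself when its
    colour carries a loop; the left side compensates for this. *)
Lemma card_nbhd_blowup (x : V) :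
  #|nbhd blowup x| + r (col x) (col x) = \sum_(j | r (col x) j) #|fibre j|.
Proof.
have -> : \sum_(j | r (col x) j) #|fibre j| = #|[set y | r (col x) (col y)]|.
  rewrite -sum1_card (partition_big col (r (col x))) /=; last by move=> y; rewrite inE.
  apply: eq_bigr => j rj; rewrite -sum1_card; apply: eq_bigl => y; rewrite !inE.
  by case: eqP => [->|]; rewrite ?rj ?andbF.
rewrite [RHS](cardsD1 x) inE addnC; congr (_ + _); apply: eq_card => y.
by rewrite !inE adj_blowup eq_sym.
Qed.

Hypothesis twin_free : forall i j, i != j -> r i j ->
  exists m, [&& m != i, m != j & r i m (+) r j m].
Hypothesis fibre2 : forall i, 2 <= #|fibre i|.
Hypothesis fibre3 : forall i, r i i -> 3 <= #|fibre i|.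
Hypothesis r_conn : forall i j, connect r i j.
Hypothesis r_nbr : forall i, exists2 j, j != i & r i j.

Lemma fibre_inh i : exists x, col x = i.
Proof.
have /card_gt0P[x] : 0 < #|fibre i| by apply: leq_trans (fibre2 i).
by rewrite inE => /eqP; exists x.
Qed.

(** A path of colours lifts step by step, choosing any vertex of the next colour;
    at a loop the chosen vertex may be the current one.  The lift ends at some
    vertex of the right colour, which a common neighbour links to the target. *)
Lemma connected_blowup : connected_graph blowup.
Proof.
have adj1 x y : r (col x) (col y) -> connect (adj blowup) x y.
  case: (eqVneq x y) => [-> _|xy rxy]; first exact: connect0.
  by apply: connect1; rewrite adj_blowup xy.
have same x y : col x = col y -> connect (adj blowup) x y.
  move=> exy; have [j _ rj] := r_nbr (col x); have [z ez] := fibre_inh j.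
  apply: (@connect_trans _ _ z); apply: adj1; first by rewrite ez.
  by rewrite ez -exy r_sym.
apply/forallP => x; apply/forallP => y.
have /connectP[p] := r_conn (col x) (col y).
elim: p x => [|i p IH] x /=; first by move=> _ /esym/same.
have [z <-] := fibre_inh i => /andP[rxz rp] e.
by apply: connect_trans (adj1 _ _ rxz) (IH z rp e).
Qed.

Lemma twin_fibre (x y : V) : col x = col y -> twin blowup x y.
Proof.
move=> e; rewrite /twin; case rii: (r (col x) (col x)); apply/orP; [right|left];
  apply/eqP/setP => z; rewrite !inE !adj_blowup -e.
  case: (eqVneq z x) => [->|zx] /=; first by rewrite rii orbC andbT; case: eqVneq.
  by case: (eqVneq z y) => [->|zy] //=; rewrite -e rii.
case: (eqVneq x z) => [<-|] /=; first by rewrite rii andbF.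
by case: (eqVneq y z) => [<-|] //=; rewrite -e rii.
Qed.

(** Adjacent twins have equal closed neighbourhoods, as neither lies in its own
    open one.  For distinct colours, a third colour adjacent to exactly one of
    the two refutes this equality. *)
Lemma adj_twin_fibre (x y : V) : adj blowup x y -> twin blowup x y -> col x = col y.
Proof.
move=> xy tw; apply/eqP/negPn/negP => ne.
have rxy : r (col x) (col y) by move: xy; rewrite adj_blowup => /andP[].
have cxy : closed_nbhd blowup x = closed_nbhd blowup y.
  case/orP: tw => /eqP // /setP/(_ y).
  by rewrite !inE xy adj_irr // simple_blowup.
have [m /and3P[mi mj]] := twin_free ne rxy.
have [z ez] := fibre_inh m; move: mi mj; rewrite -ez => zi zj.
have zx : z != x by apply: contraNneq zi => ->.
have zy : z != y by apply: contraNneq zj => ->.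
move/setP/(_ z): cxy; rewrite !inE !adj_blowup (negPf zx) (negPf zy) /=.
by rewrite ![_ == z]eq_sym zx zy /= => ->; rewrite addbb.
Qed.

(** A twin class may be a union of several fibres; it is enough that it contains
    a fibre, and that adjacent twins share a colour, whose fibre is then a clique
    of at least three vertices in their class. *)
Lemma anosov_blowup : anosov blowup.
Proof.
have teq := twin_equiv simple_blowup.
apply/and4P; split.
- exact: simple_blowup.
- exact: connected_blowup.
- apply/forall_inP => C /imsetP[x _ ->].
  apply: leq_trans (fibre2 (col x)) (subset_leq_card _).
  by apply/subsetP => y; rewrite !inE => /eqP e; apply: twin_fibre.
- apply/forall_inP => C /imsetP[x _ ->]; apply/implyP => /eqP c2.
  apply/forall_inP => y; rewrite inE in_setT /= => xy.
  apply/forall_inP => z; rewrite inE in_setT /= => xz.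
  apply/negP => yz; have tyz : twin blowup y z.
    by have [_ /(_ xy) <-] := teq x y z (in_setT _) (in_setT _) (in_setT _).
  have e := adj_twin_fibre yz tyz.
  have ryy : r (col y) (col y).
    by move: yz; rewrite adj_blowup -e => /andP[].
  have := fibre3 ryy; rewrite leqNgt ltnS => /negP; apply.
  rewrite -c2; apply: subset_leq_card; apply/subsetP => v; rewrite !inE => /eqP ev.
  have [_ /(_ xy) ->] := teq x y v (in_setT _) (in_setT _) (in_setT _).
  by apply: twin_fibre; rewrite ev.
Qed.
End Blowup.

(** * Counting the edges of a blow-up *)

Lemma handshake (V : finType) (E : {set {set V}}) :
  simple_graph E -> \sum_x #|nbhd E x| = #|E|.*2.
Proof.
move=> sE.
have deg x : #|nbhd E x| = \sum_(e in E) (x \in e).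
  have -> : \sum_(e in E) (x \in e) = #|[set e in E | x \in e]|.
    rewrite -sum1_card big_mkcond /= [RHS]big_mkcond; apply: eq_bigr => e _.
    by rewrite inE; case: (e \in E).
  rewrite -(@card_in_imset _ _ (fun y => [set x; y])).
    apply: eq_card => e; apply/imsetP/idP => [[y]|].
      by rewrite inE => xy ->; rewrite inE set21 andbT.
    rewrite inE => /andP[eE xe].
    have /cards2P[u [v [uv ee]]] := forall_inP sE e eE.
    move: xe eE; rewrite {}ee !inE => /orP[/eqP->|/eqP->] eE; first by exists v; rewrite ?inE.
    by exists u; rewrite ?inE /adj setUC.
  by move=> y z _ _ /set2_inj[[]|[->]].
rewrite (eq_bigr _ (fun x _ => deg x)) exchange_big /= -muln2 -sum_nat_const.
apply: eq_bigr => e /(forall_inP sE)/eqP <-.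
by rewrite -sum1_card [RHS]big_mkcond; apply: eq_bigr => x _; case: (x \in e).
Qed.

Lemma sum_fibre (V T : finType) (col : V -> T) (g : T -> nat) :
  \sum_x g (col x) = \sum_i #|fibre col i| * g i.
Proof.
rewrite (partition_big col predT) //=; apply: eq_bigr => i _.
rewrite -sum_nat_const; apply: eq_big => x; first by rewrite inE.
by move/eqP->.
Qed.

(** The sum of the degrees, with each loop counted as in [card_nbhd_blowup]. *)
Lemma card_edges_blowup (V T : finType) (r : rel T) (col : V -> T) :
  symmetric r ->
  #|blowup r col|.*2 + \sum_(i | r i i) #|fibre col i|
    = \sum_i #|fibre col i| * \sum_(j | r i j) #|fibre col j|.
Proof.
move=> r_sym; rewrite -handshake; last exact: simple_blowup.
rewrite -sum_fibre -(eq_bigr _ (fun x _ => card_nbhd_blowup col r_sym x)) big_split /=.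
congr (_ + _); rewrite (sum_fibre col (fun i => r i i : nat)) big_mkcond /=.
by apply: eq_bigr => i _; case: (r i i); rewrite ?muln1 ?muln0.
Qed.

(** The disjoint union of sets of sizes [s i] has [k] elements, so it can be
    numbered by ['I_k]; the colour of a number is the summand it falls in. *)
Lemma colouring_exists (T : finType) (s : T -> nat) (k : nat) :
  \sum_i s i = k -> exists col : 'I_k -> T, forall i, #|fibre col i| = s i.
Proof.
move=> <-; pose W := {i : T & 'I_(s i)}.
have eW : \sum_i s i = #|{: W}|.
  rewrite card_tagged sumnE big_map big_enum /=.
  by apply: eq_bigr => i _; rewrite card_ord.
exists (fun x => tag (enum_val (cast_ord eW x))) => i.
transitivity #|[set w : W | tag w == i]|.
  rewrite -(@on_card_preimset _ _ (fun x => enum_val (cast_ord eW x))).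
    by apply: eq_card => x; rewrite !inE.
  apply: onW_bij; apply: bij_comp; first exact: enum_val_bij.
  by exists (cast_ord (esym eW)) => x; rewrite ?cast_ordK ?cast_ordKV.
transitivity #|[set (Tagged (fun i => 'I_(s i)) x : W) | x : 'I_(s i)]|.
  apply: eq_card => -[j x]; rewrite inE /=; apply/eqP/imsetP => [e|[y _ e]].
    by subst j; exists x.
  by have := congr1 tag e.
by rewrite card_imset ?card_ord // => x y /eqP; rewrite eq_Tagged => /eqP.
Qed.

(** * Bounding the number of isomorphism classes from below *)

Definition nb_deg2 (V : finType) (E : {set {set V}}) : nat :=
  #|[set x | #|nbhd E x| == 2]|.

Lemma isomorphic_nb_deg2 (V : finType) (E F : {set {set V}}) :
  isomorphic E F -> nb_deg2 E = nb_deg2 F.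
Proof.
case/existsP=> s sP; have nbhdE x : nbhd F (s x) = s @: nbhd E x.
  apply/setP => y; rewrite -[y](permKV s) mem_imset; last exact: perm_inj.
  by rewrite !inE; apply/eqP; apply: (forallP (forallP sP x)).
rewrite /nb_deg2 -(card_imset _ (@perm_inj _ s)); apply: eq_card => y.
rewrite -[y](permKV s) mem_imset; last exact: perm_inj.
by rewrite !inE nbhdE card_imset //; apply: perm_inj.
Qed.

(** Each class has a one-point image under [f], so the classes map onto the
    singletons of the values of [f]. *)
Lemma leq_card_invariant (T U : finType) (e : rel T) (f : T -> U) (S : {set T}) :
    {in S & &, equivalence_rel e} -> (forall x y, e x y -> f x = f y) ->
  #|f @: S| <= #|equivalence_partition e S|.
Proof.
move=> eqe fe; rewrite -(card_imset _ set1_inj).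
apply: leq_trans (leq_imset_card (fun C : {set T} => f @: C) _).
apply/subset_leq_card/subsetP => _ /imsetP[_ /imsetP[x xS ->] ->].
apply/imsetP; exists [set y in S | e x y]; first exact: imset_f.
apply/setP => u; rewrite inE; apply/eqP/imsetP => [->|[y]].
  by exists x; rewrite // inE xS; have [-> _] := eqe x x x xS xS xS.
by rewrite inE => /andP[_ /fe ->].
Qed.

(** The labels [i] realised with [k] vertices are no more than the isomorphism
    classes with [k] vertices, and the [k <= w] together realise all [p] labels. *)
Lemma nu_ge (w p c : nat) :
    (forall i, i < p -> exists2 k, k <= w & exists E : {set {set 'I_k}},
       [/\ anosov E, #|E| = w - k & nb_deg2 E = c + i]) ->
  p <= nu w.
Proof.
case: p => // p realize.
pose S k : {set {set {set 'I_k}}} := [set E | anosov E & #|E| == w - k].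
pose lab k (E : {set {set 'I_k}}) : 'I_p.+1 := inord (nb_deg2 E - c).
have cover : [set: 'I_p.+1] \subset \bigcup_(k < w.+1) (@lab k @: S k).
  apply/subsetP => i _; have [k kw [E [aE lE dE]]] := realize i (ltn_ord i).
  have kw' : k < w.+1 by [].
  apply/bigcupP; exists (Ordinal kw') => //; apply/imsetP; exists E.
    by rewrite inE aE lE /=.
  by rewrite /lab dE addKn inord_val.
have := subset_leq_card cover; rewrite cardsT card_ord => /leq_trans; apply.
apply: (@leq_trans (\sum_(k < w.+1) #|@lab k @: S k|)).
  elim/big_rec2: _ => [|k n A _ le]; first by rewrite cards0.
  by rewrite (leq_trans (leq_card_setU _ _)) // leq_add2l.
apply: leq_sum => k _; apply: leq_card_invariant.
  by move=> E F G _ _ _; apply: isomorphic_equiv.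
by move=> E F /isomorphic_nb_deg2; rewrite /lab => ->.
Qed.

(** * Blow-ups of a path on five points *)

Section Path5.
Variables (q : bool) (a f d : nat).

(** The loop at point 3, present when [q] holds, makes its class a triangle. *)
Definition path5 : rel 'I_5 := fun i j =>
  [|| j == i.+1 :> nat, i == j.+1 :> nat | [&& q, i == 3 :> nat & j == 3 :> nat]].

(** Size 2 at point 1 gives the vertices over point 0 degree 2; size 3 at point 3
    gives those over point 4 degree 3 and is the least size of a clique class. *)
Definition size5 (i : 'I_5) : nat := nth 0 [:: a; 2; f; 3; d] i.

Lemma path5_sym : symmetric path5.
Proof. by move=> i j; rewrite /path5; lia. Qed.

Lemma path5_conn i j : connect path5 i j.
Proof.
have to0 : forall n (k : 'I_5), k = n :> nat -> connect path5 k ord0.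
  elim=> [|n IH] k ek; first by rewrite (_ : k = ord0) //; apply: val_inj.
  have n5 : n < 5 by have := ltn_ord k; lia.
  apply: connect_trans (IH (Ordinal n5) erefl); apply: connect1.
  by rewrite /path5 /= ek eqxx orbT.
apply: connect_trans (to0 i i erefl) _.
by rewrite (sym_connect_sym path5_sym); apply: (to0 j).
Qed.

Lemma path5_nbr i : exists2 j, j != i & path5 i j.
Proof.
case: i => [[|[|[|[|[|//]]]]] ?];
  [exists (inord 1)|exists (inord 0)|exists (inord 1)|exists (inord 2)|exists (inord 3)];
  by rewrite -?val_eqE /path5 /= !inordK.
Qed.

(** Adjacent points of a path have no common neighbour, so any further neighbour
    of either one distinguishes them. *)
Lemma path5_twin_free i j : i != j -> path5 i j ->
  exists m, [&& m != i, m != j & path5 i m (+) path5 j m].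
Proof.
case: i => [[|[|[|[|[|//]]]]] ?]; case: j => [[|[|[|[|[|//]]]]] ?] //;
  rewrite /path5 -?val_eqE //= => _ _;
  solve [ exists (inord 0); rewrite -!val_eqE /= !inordK //= ?andbF //
        | exists (inord 1); rewrite -!val_eqE /= !inordK //= ?andbF //
        | exists (inord 2); rewrite -!val_eqE /= !inordK //= ?andbF //
        | exists (inord 3); rewrite -!val_eqE /= !inordK //= ?andbF //
        | exists (inord 4); rewrite -!val_eqE /= !inordK //= ?andbF //].
Qed.

Lemma sum_path5 (i : 'I_5) :
  \sum_(j | path5 i j) size5 j = nth 0 [:: 2; a + f; 5; f + 3 * q + d; 3] i.
Proof.
rewrite big_mkcond !big_ord_recl big_ord0 /path5 /size5 /=.
by case: i => [[|[|[|[|[|//]]]]] ?] /=; case: q => /=; lia.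
Qed.

Lemma path5_anosov : 1 < a -> 1 < f -> 1 < d ->
  let k := a + f + d + 5 in
  exists E : {set {set 'I_k}},
    [/\ anosov E, #|E| = 2 * a + 5 * f + 3 * d + 3 * q & nb_deg2 E = a].
Proof.
move=> a2 f2 d2 k.
have [|col sz] := @colouring_exists _ size5 k.
  by rewrite !big_ord_recl big_ord0 /size5 /=; lia.
exists (blowup path5 col); split.
- apply: anosov_blowup.
  + exact: path5_sym.
  + exact: path5_twin_free.
  + by move=> i; rewrite sz; case: i => [[|[|[|[|[|//]]]]] ?].
  + by move=> i; rewrite sz; case: i => [[|[|[|[|[|//]]]]] ?] //; rewrite /path5 /=; lia.
  + exact: path5_conn.
  + exact: path5_nbr.
- have := card_edges_blowup col path5_sym.
  rewrite (eq_bigr _ (fun i _ => sz i)).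
  rewrite [RHS](eq_bigr (fun i => size5 i * nth 0 [:: 2; a + f; 5; f + 3 * q + d; 3] i)).
    rewrite big_mkcond; move: #|_| => e.
    by rewrite !big_ord_recl !big_ord0 /path5 /size5 /=; case: q => /=; lia.
  by move=> i _; rewrite sz -sum_path5; congr (_ * _); apply: eq_bigr.
- rewrite /nb_deg2 -[RHS](sz ord0); apply: eq_card => x; rewrite !inE.
  have := card_nbhd_blowup col path5_sym x.
  rewrite (eq_bigr _ (fun i _ => sz i)) sum_path5.
  move: #|nbhd _ _| => deg.
  by rewrite -val_eqE /path5; case: (col x) => [[|[|[|[|[|//]]]]] ?] /=; case: q => /=; lia.
Qed.
End Path5.

(** * The bound *)

Lemma nu_ge_third (w : nat) : (w - 34) %/ 3 <= nu w.
Proof.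
apply: (@nu_ge _ _ 2) => i ip.
have [f [d [q [f2 d2 ew]]]] : exists f d (q : bool),
    [/\ 1 < f, 1 < d & 3 * (2 + i) + 6 * f + 4 * d + 3 * q + 5 = w].
  (* 17 is the value of [6 * f + 5] at [f = 2]; the residue of [t] modulo 4
     decides between [f = 2] and [f = 3] and whether to take the triangle. *)
  pose t := w - 3 * (2 + i) - 17.
  have tE : w = 3 * (2 + i) + 17 + t by lia.
  have t14 : 14 <= t by lia.
  have := divn_eq t 4; have := ltn_pmod t (isT : 0 < 4).
  case: (t %% 4) => [|[|[|[|//]]]] _ et.
  - by exists 2, (t %/ 4), false; split; lia.
  - by exists 3, ((t %/ 4) - 2), true; split; lia.
  - by exists 3, ((t %/ 4) - 1), false; split; lia.
  - by exists 2, (t %/ 4), true; split; lia.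
exists (2 + i + f + d + 5); first by lia.
have [E [aE lE dE]] := path5_anosov q (isT : 1 < 2 + i) f2 d2.
by exists E; split=> //; rewrite lE; lia.
Qed.

Local Open Scope ring_scope.

Theorem theorem4p8 (R : realType) (n m : nat) (hn : (1 <= n)%N) :
  (nu (n + m))%:R >
    (n + m)%:R / 3%:R - Num.sqrt (2%:R * (n + m)%:R) - 9%:R / 2%:R :> R.
Proof.
have : (0 < n + m)%N by lia.
move: (n + m)%N => w w_gt0.
have nuR : w%:R <= 3 * (nu w)%:R + 36 :> R.
  by rewrite -natrM -natrD ler_nat; have := nu_ge_third w; lia.
have w0 : 0 < w%:R :> R by rewrite ltr0n.
have nu0 : 0 <= (nu w)%:R :> R by [].
have := sqr_sqrtr (ltW (mulr_gt0 (ltr0Sn R 1) w0)).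
have := sqrtr_ge0 (2%:R * w%:R : R).
set x := Num.sqrt _ => x0 xE.
have [x9|x9] := ltP x 9; last by lra.
nra.
Qed.
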